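(* Let $M_{mon}$ denote the problem of computing, from the coefficient vectors of two polynomials in $\mathbb{R}[x]$ of degree $d=n-1$ expressed in the monomial basis $(x^k)_{k\ge0}$, the coefficient vector of their product in the monomial basis; and let $M_{che}$ denote the problem of computing, from the coefficient vectors of two polynomials in $\mathbb{R}[x]$ of degree $d=n-1$ expressed in the Chebyshev basis $(T_k)_{k\ge0}$, the coefficient vector of their product in the Chebyshev basis. Then $M_{mon}$ and $M_{che}$ are equivalent under linear-time transforms: each problem can be solved using two calls to an algorithm for the other problem (on inputs of the same size $n$) plus $O(n)$ additional arithmetic operations in $\mathbb{R}$; that is, the constant of both reductions is equal to two.
   Context: Chebyshev polynomials of the first kind are defined by $T_0(x)=1$, $T_1(x)=x$, $T_k(x)=2xT_{k-1}(x)-T_{k-2}(x)$ for $k\ge 2$; they form a basis of the $\mathbb{R}$-vector space $\mathbb{R}[x]$, and satisfy $T_iT_j=\frac12(T_{i+j}+T_{|i-j|})$ for all $i,j\ge0$. Data movements (copying, reversing coefficient vectors) are free; only arithmetic operations in $\mathbb{R}$ are counted. *)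

(* Defs.v *)
From mathcomp Require Import all_boot all_order all_algebra.
From mathcomp Require Import reals.

Set Implicit Arguments.
Unset Strict Implicit.
Unset Printing Implicit Defensive.

Import Order.TTheory GRing.Theory Num.Theory.
Local Open Scope ring_scope.

Section Bases.
Variable R : realType.

Fixpoint chebyshev (k : nat) : {poly R} :=
  match k with
  | 0 => 1
  | 1 => 'X
  | (k2.+1 as k1).+1 => 2 *: 'X * chebyshev k1 - chebyshev k2
  end.

Definition monomial (k : nat) : {poly R} := 'X^k.

(* The polynomial with coefficient vector v in the basis b. *)
Definition lincomb (b : nat -> {poly R}) (m : nat) (v : 'rV[R]_m) : {poly R} :=
  \sum_(i < m) v 0 i *: b i.

(* Input/output behaviour of a procedure on two vectors of n coefficients     *)
(* (degree n - 1), returning 2n - 1 coefficients; None means that the         *)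
(* procedure fails, e.g. on a division by zero.                               *)
Definition procedure (n : nat) : Type :=
  'rV[R]_n -> 'rV[R]_n -> option 'rV[R]_(n + n).-1.

Definition solves_mul (b : nat -> {poly R}) (n : nat) (A : procedure n) : Prop :=
  forall u v : 'rV[R]_n, exists2 w : 'rV[R]_(n + n).-1,
    A u v = Some w & lincomb b w = lincomb b u * lincomb b v.

End Bases.

(* Straight-line programs over R with calls to a black-box procedure of size  *)
(* n. The memory is an append-only sequence of reals: each instruction reads  *)
(* operands by address and appends its results, so copying and reordering     *)
(* data costs nothing.                                                        *)

Inductive arith := Add | Sub | Mul | Div.

Section Programs.
Variables (R : realType) (n : nat).

Inductive instr :=
  | Const (c : R)
  | Op (o : arith) (i j : nat)
  | Call (a b : n.-tuple nat).

Record program := Program {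
  code : seq instr;
  output : (n + n).-1.-tuple nat }.

Definition arith_eval (o : arith) (x y : R) : option R :=
  match o with
  | Add => Some (x + y)
  | Sub => Some (x - y)
  | Mul => Some (x * y)
  | Div => if y == 0 then None else Some (x / y)
  end.

Definition load (m : nat) (s : seq R) (a : m.-tuple nat) : option 'rV[R]_m :=
  if all (fun i => i < size s)%N a then Some (\row_k s`_(tnth a k)) else None.

Definition entries (m : nat) (v : 'rV[R]_m) : seq R := [seq v 0 k | k : 'I_m].

Definition step (A : procedure R n) (s : seq R) (c : instr) : option (seq R) :=
  match c with
  | Const x => Some (rcons s x)
  | Op o i j =>
      if ((i < size s) && (j < size s))%N
      then omap (rcons s) (arith_eval o s`_i s`_j) else None
  | Call a b =>
      if (load s a, load s b) is (Some u, Some v)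
      then omap (fun w => s ++ entries w) (A u v) else None
  end.

Definition run (A : procedure R n) (cs : seq instr) (s : seq R) :
    option (seq R) :=
  foldl (fun os c => obind (fun s' => step A s' c) os) (Some s) cs.

Definition exec (A : procedure R n) (P : program) : procedure R n :=
  fun u v =>
    obind (fun s => load s (output P)) (run A (code P) (entries u ++ entries v)).

Definition num_ops (P : program) : nat :=
  count (fun c => if c is Op _ _ _ then true else false) (code P).

Definition num_calls (P : program) : nat :=
  count (fun c => if c is Call _ _ then true else false) (code P).

End Programs.

(* Multiplication in the basis b reduces to multiplication in the basis b',   *)
(* with constant k: k calls, on inputs of the same size n, plus O(n)          *)
(* arithmetic operations.                                                     *)
Definition linear_time_reduction (R : realType) (k : nat)
    (b b' : nat -> {poly R}) : Prop :=
  exists C : nat, forall n : nat, (0 < n)%N ->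
    exists P : program R n,
      [/\ num_calls P = k, (num_ops P <= C * n)%N &
          forall A : procedure R n, solves_mul b' A -> solves_mul b (exec A P)].

(* Main.v *)
Require Import Defs.
From mathcomp Require Import all_boot all_order all_algebra.
From mathcomp Require Import boolp classical_sets reals.
From mathcomp Require Import zify ring.

(* Write d = n - 1, conv_k for the sum of the u_i v_j over i + j = k, and       *)
(* corr_k for the same sum over |i - j| = k. The monomial coefficients of a     *)
(* product are the conv_k; since T_i T_j = (T_(i+j) + T_|i-j|) / 2, the         *)
(* Chebyshev ones are (conv_k + corr_k) / 2.                                    *)
(*   From monomial to Chebyshev: multiplying u by v gives conv, and multiplying *)
(* u by the reversal of v gives the sums over a fixed i - j, hence corr.        *)
(*   From Chebyshev to monomial: corr_k = 0 for k > d, so multiplying u by v    *)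
(* gives conv_k for k > d, and multiplying the reversals gives conv_(2d-k) for  *)
(* k > d. The only one left is conv_d, corrected by corr_d, which has at most   *)
(* two terms: u_0 v_d and u_d v_0.                                              *)
(*   As moving data is free, addresses play no role in counting operations: it  *)
(* is enough to follow which functions of the input have been computed.         *)

Set Implicit Arguments.
Unset Strict Implicit.
Unset Printing Implicit Defensive.

Import Order.TTheory GRing.Theory Num.Theory.
Local Open Scope ring_scope.
Local Open Scope classical_set_scope.

Definition graded (R : nzRingType) (b : nat -> {poly R}) : Prop :=
  forall k, size (b k) = k.+1.

Lemma graded_free (R : idomainType) (b : nat -> {poly R}) m (c : 'I_m -> R) :
  graded b -> \sum_(i < m) c i *: b i = 0 -> forall i, c i = 0.
Proof.
move=> graded_b; elim: m c => [|m IH] c; first by move=> _ [].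
rewrite big_ord_recr /= => sum0.
have c_max : c ord_max = 0.
  have low : (\sum_(i < m) c (widen_ord (leqnSn m) i) *: b i)`_m = 0.
    rewrite coef_sum big1 // => i _.
    by rewrite coefZ nth_default ?mulr0 ?graded_b.
  have /eqP := congr1 (fun p : {poly R} => p`_m) sum0.
  rewrite coefD low add0r coefZ coef0 mulf_eq0 => /orP[/eqP//|].
  have -> : (b m)`_m = lead_coef (b m) by rewrite lead_coefE graded_b.
  by rewrite lead_coef_eq0 -size_poly_eq0 graded_b.
rewrite c_max scale0r addr0 in sum0 => i.
case: (unliftP ord_max i) => [j ->|->] //.
by rewrite -(IH _ sum0 j); congr c; apply/val_inj/lift_max.
Qed.

Section FiberSums.
Variables (R : pzRingType) (n : nat).
Implicit Types (u v : 'rV[R]_n) (h : nat -> nat -> nat).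

Definition fiber_sum h u v (k : nat) : R :=
  \sum_(p : 'I_n * 'I_n | h p.1 p.2 == k) u 0 p.1 * v 0 p.2.

Definition conv := fiber_sum addn.

Definition corr := fiber_sum (fun i j => `|i - j|)%N.

Definition reversal u : 'rV[R]_n := colsub (@rev_ord n) u.

Lemma sum_fiber_sum (V : lmodType R) (b : nat -> V) m h u v :
  (forall i j : 'I_n, h i j < m)%N ->
  \sum_(k < m) fiber_sum h u v k *: b k =
  \sum_(p : 'I_n * 'I_n) (u 0 p.1 * v 0 p.2) *: b (h p.1 p.2).
Proof.
move=> h_lt; pose h_ord (p : 'I_n * 'I_n) := Ordinal (h_lt p.1 p.2).
rewrite [RHS](partition_big h_ord xpredT) //=; apply: eq_bigr => k _.
by rewrite scaler_suml; apply: eq_bigr => p /eqP<-.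
Qed.

Lemma mul_sum_scale (A : algType R) (b : nat -> A) u v :
  (\sum_(i < n) u 0 i *: b i) * (\sum_(j < n) v 0 j *: b j) =
  \sum_(p : 'I_n * 'I_n) (u 0 p.1 * v 0 p.2) *: (b p.1 * b p.2).
Proof.
rewrite big_distrlr pair_bigA; apply: eq_bigr => p _ /=.
by rewrite -scalerAl -scalerAr scalerA.
Qed.

Lemma fiber_sum_reversall h u v k :
  fiber_sum h (reversal u) v k =
  fiber_sum (fun i j => h (n - i.+1)%N j) u v k.
Proof.
have flipK : involutive (fun p : 'I_n * 'I_n => (rev_ord p.1, p.2)).
  by move=> [i j]; rewrite /= rev_ordK.
rewrite /fiber_sum (reindex_inj (inv_inj flipK)).
by apply: eq_bigr => p _ /=; rewrite mxE rev_ordK.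
Qed.

Lemma fiber_sum_reversalr h u v k :
  fiber_sum h u (reversal v) k =
  fiber_sum (fun i j => h i (n - j.+1)%N) u v k.
Proof.
have flipK : involutive (fun p : 'I_n * 'I_n => (p.1, rev_ord p.2)).
  by move=> [i j]; rewrite /= rev_ordK.
rewrite /fiber_sum (reindex_inj (inv_inj flipK)).
by apply: eq_bigr => p _ /=; rewrite mxE rev_ordK.
Qed.

Lemma conv_reversal u v k : (k <= (n + n).-2)%N ->
  conv (reversal u) (reversal v) k = conv u v ((n + n).-2 - k).
Proof.
move=> le_k; rewrite /conv fiber_sum_reversall fiber_sum_reversalr.
by apply: eq_bigl => -[[i lt_i] [j lt_j]] /=; lia.
Qed.

Lemma corr_eq0 u v k : (n <= k)%N -> corr u v k = 0.
Proof.
by move=> le_nk; apply: big_pred0 => -[[i lt_i] [j lt_j]] /=; lia.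
Qed.

Lemma corr0 u v : corr u v 0 = conv u (reversal v) n.-1.
Proof.
rewrite /conv fiber_sum_reversalr.
by apply: eq_bigl => -[[i lt_i] [j lt_j]] /=; lia.
Qed.

Lemma corr_reversal u v k : (0 < k < n)%N ->
  corr u v k =
  conv u (reversal v) (n.-1 + k) + conv u (reversal v) (n.-1 - k).
Proof.
move=> k_in; rewrite /conv !fiber_sum_reversalr /corr /fiber_sum.
rewrite (bigID (fun p : 'I_n * 'I_n => p.2 < p.1)%N) /=.
by congr (_ + _); apply: eq_bigl => -[[i lt_i] [j lt_j]] /=; lia.
Qed.

End FiberSums.

Lemma corr_ord_max (R : pzRingType) d (u v : 'rV[R]_d.+1) : (0 < d)%N ->
  corr u v d = u 0 ord0 * v 0 ord_max + u 0 ord_max * v 0 ord0.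
Proof.
move=> d_gt0; rewrite /corr /fiber_sum (bigD1 (ord0, ord_max)) /=; last by lia.
rewrite (big_pred1 (ord_max, ord0)) // => -[[i lt_i] [j lt_j]] /=.
by rewrite !xpair_eqE -!val_eqE /=; lia.
Qed.

Lemma corr_ord_max0 (R : pzRingType) d (u v : 'rV[R]_d.+1) : d = 0%N ->
  corr u v d = u 0 ord0 * v 0 ord0.
Proof.
move=> d0; rewrite /corr /fiber_sum (big_pred1 (ord0, ord0)) //.
by move=> -[[i lt_i] [j lt_j]] /=; rewrite xpair_eqE -!val_eqE /=; lia.
Qed.

Section Bases.
Variable R : realType.
Local Notation T := (chebyshev R).

Lemma graded_monomial : graded (@monomial R).
Proof. by move=> k; apply: size_polyXn. Qed.

Lemma chebyshevSS k : T k.+2 = 2 * 'X * T k.+1 - T k.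
Proof. by rewrite /= scaler_nat mulr_natl. Qed.

Lemma graded_chebyshev : graded (@chebyshev R).
Proof.
move=> k; elim/ltn_ind: k => -[|[|k]] IH.
- exact: size_poly1.
- exact: size_polyX.
have size_top : size (2 * 'X * T k.+1) = k.+3.
  rewrite mulrAC mulr_natl -scaler_nat size_mulX -?size_poly_eq0.
    by rewrite size_scale ?pnatr_eq0 // IH.
  by rewrite size_scale ?pnatr_eq0 // IH.
by rewrite chebyshevSS size_polyDl size_top // size_polyN IH.
Qed.

Lemma mul_chebyshev_addl i j : 2 * (T i * T (i + j)) = T (i + i + j) + T j.
Proof.
elim/ltn_ind: i j => -[|[|i]] IH j.
- by rewrite /= !add0n; ring.
- by rewrite !addSn add0n chebyshevSS /=; ring.
have IH1 := IH i.+1 (ltnSn _) j.+1; have IH0 := IH i (ltnW (ltnSn _)) j.+2.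
rewrite !addSn !addnS in IH0 IH1 *.
rewrite (chebyshevSS i) (chebyshevSS (i + i + j).+2).
transitivity
  (2 * 'X * (2 * (T i.+1 * T (i + j).+2)) - 2 * (T i * T (i + j).+2)).
  by ring.
by rewrite IH0 IH1 (chebyshevSS j); ring.
Qed.

Lemma mul_chebyshev i j : T i * T j = 2^-1 *: (T (i + j) + T `|i - j|%N).
Proof.
wlog le_ij : i j / (i <= j)%N.
  move=> mul_le; case/orP: (leq_total i j) => /mul_le // mul_ji.
  by rewrite mulrC mul_ji addnC distnC.
rewrite -{1 2}(subnKC le_ij) addnA distnEr // -mul_chebyshev_addl.
by rewrite mulr_natl -scaler_nat scalerA mulVf ?scale1r ?pnatr_eq0.
Qed.

Lemma lincomb_inj (b : nat -> {poly R}) n :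
  graded b -> injective (@lincomb R b n).
Proof.
move=> graded_b u v /eqP; rewrite -subr_eq0 -sumrB => /eqP sum0.
apply/rowP => i; apply/eqP; rewrite -subr_eq0; apply/eqP; move: i.
apply: (graded_free graded_b); rewrite -[RHS]sum0.
by apply: eq_bigr => i _; rewrite scalerBl.
Qed.

Definition product_coefs (b : nat -> {poly R})
    (F : forall n, 'rV[R]_n -> 'rV[R]_n -> nat -> R) : Prop :=
  forall n (u v : 'rV[R]_n),
    lincomb b (\row_(k < (n + n).-1) F n u v k) = lincomb b u * lincomb b v.

Definition chebyshev_conv n (u v : 'rV[R]_n) (k : nat) : R :=
  (conv u v k + corr u v k) / 2.

Lemma conv_of_chebyshev n (u v : 'rV[R]_n) k :
  conv u v k = chebyshev_conv u v k + chebyshev_conv u v k - corr u v k.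
Proof. by rewrite /chebyshev_conv; field. Qed.

Lemma product_coefs_monomial : product_coefs (@monomial R) (@conv R).
Proof.
move=> n u v; rewrite /lincomb mul_sum_scale; under eq_bigr do rewrite mxE.
rewrite sum_fiber_sum => [|[i lt_i] [j lt_j] /=]; last by lia.
by apply: eq_bigr => p _; rewrite /monomial exprD.
Qed.

Lemma product_coefs_chebyshev : product_coefs (@chebyshev R) chebyshev_conv.
Proof.
move=> n u v; rewrite /lincomb mul_sum_scale.
under eq_bigr do rewrite mxE /chebyshev_conv mulrC -scalerA scalerDl scalerDr.
rewrite big_split /= -!scaler_sumr.
rewrite !sum_fiber_sum; try by move=> [i lt_i] [j lt_j] /=; lia.
rewrite -scalerDr -big_split scaler_sumr; apply: eq_bigr => p _ /=.
by rewrite mul_chebyshev -scalerDr !scalerA mulrC.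
Qed.

End Bases.

Section ComputableValues.
Variables (R : realType) (n : nat) (F : 'rV[R]_n -> 'rV[R]_n -> nat -> R).
Local Notation value := ('rV[R]_n -> 'rV[R]_n -> R).
Local Notation degrees := (iota 0 (n + n).-1).
Implicit Types (x y z : value) (a b : 'rV[R]_n -> 'rV[R]_n -> 'rV[R]_n).
Implicit Types (f g h : 'rV[R]_n -> 'rV[R]_n -> nat -> R).
Implicit Types (t : seq value) (X Y : set value).

Definition oracle : procedure R n := fun u v => Some (\row_k F u v k).

Definition is_call (c : instr R n) : bool :=
  if c is Call _ _ then true else false.

Definition is_op (c : instr R n) : bool :=
  if c is Op _ _ _ then true else false.

Definition eval_at t (u v : 'rV[R]_n) : seq R := [seq x u v | x <- t].

(* Run on a generic input, a program fills its memory with a sequence t of      *)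
(* functions of this input; X is the part of t that we keep track of.           *)
Definition computable (K N : nat) X : Prop :=
  exists (cs : seq (instr R n)) t,
    [/\ count is_call cs = K, (count is_op cs <= N)%N, X `<=` [set` t] &
        forall u v,
          run oracle cs (entries u ++ entries v) = Some (eval_at t u v)].

Lemma computableW K N N' X Y :
  (N <= N')%N -> Y `<=` X -> computable K N X -> computable K N' Y.
Proof.
move=> le_N sYX [cs [t [calls ops sXt run_t]]]; exists cs, t; split=> //.
- exact: leq_trans le_N.
- exact: subset_trans sXt.
Qed.

Lemma eval_at_cat t t' u v :
  eval_at (t ++ t') u v = eval_at t u v ++ eval_at t' u v.
Proof. exact: map_cat. Qed.

Lemma nth_eval_at t x u v : x \in t -> (eval_at t u v)`_(index x t) = x u v.
Proof. by move=> x_t; rewrite (nth_map x) ?index_mem // nth_index. Qed.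

Definition addresses m t (w : 'rV[R]_n -> 'rV[R]_n -> 'rV[R]_m) :
    m.-tuple nat :=
  [tuple index (fun u v => w u v 0 k) t | k < m].

Lemma load_addresses m t (w : 'rV[R]_n -> 'rV[R]_n -> 'rV[R]_m) u v :
  (forall k, (fun u v => w u v 0 k) \in t) ->
  load (eval_at t u v) (addresses t w) = Some (w u v).
Proof.
move=> w_t; rewrite /load ifT; last first.
  by apply/allP => _ /mapP[k _ ->]; rewrite size_map index_mem.
by congr Some; apply/rowP => k; rewrite mxE tnth_mktuple nth_eval_at.
Qed.

Lemma entries_row m (f : nat -> R) : entries (\row_(k < m) f k) = mkseq f m.
Proof.
rewrite /entries /mkseq -val_enum_ord -map_comp.
by apply: eq_map => k /=; rewrite mxE.
Qed.

Definition inputs : set value :=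
  range (fun i (u v : 'rV[R]_n) => u 0 i) `|`
  range (fun i (u v : 'rV[R]_n) => v 0 i).

Lemma inputsl i : inputs (fun u v => u 0 i).
Proof. by left; exists i. Qed.

Lemma inputsr i : inputs (fun u v => v 0 i).
Proof. by right; exists i. Qed.

Lemma inputs_reversall i : inputs (fun u v => reversal u 0 i).
Proof.
by left; exists (rev_ord i) => //; apply: eq2_fun => u v; rewrite mxE.
Qed.

Lemma inputs_reversalr i : inputs (fun u v => reversal v 0 i).
Proof.
by right; exists (rev_ord i) => //; apply: eq2_fun => u v; rewrite mxE.
Qed.

Lemma computable_inputs : computable 0 0 inputs.
Proof.
exists [::], ([seq (fun u v : 'rV[R]_n => u 0 i) | i : 'I_n] ++
             [seq (fun u v : 'rV[R]_n => v 0 i) | i : 'I_n]).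
split=> // [_ [[i _ <-]|[i _ <-]] /=|u v].
- by rewrite mem_cat; apply/orP; left; apply/mapP; exists i; rewrite ?mem_enum.
- by rewrite mem_cat; apply/orP; right; apply/mapP; exists i; rewrite ?mem_enum.
- rewrite eval_at_cat /run /=.
  by congr (Some (_ ++ _)); rewrite /eval_at -map_comp.
Qed.

Definition values (s : seq nat) f : set value :=
  [set` [seq (fun u v => f u v k) | k <- s]].

Lemma mem_values s f k : k \in s -> values s f (fun u v => f u v k).
Proof. exact: map_f. Qed.

Lemma values_subset s s' f : {subset s <= s'} -> values s f `<=` values s' f.
Proof. by move=> ss' _ /mapP[k /ss' k_s' ->]; apply: mem_values. Qed.

Lemma computable_step (call op : bool) t' K N X :
  (forall t, X `<=` [set` t] -> exists c : instr R n,
     [/\ is_call c = call, is_op c = op &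
         forall u v,
           step oracle (eval_at t u v) c = Some (eval_at (t ++ t') u v)]) ->
  computable K N X -> computable (call + K) (op + N) ([set` t'] `|` X).
Proof.
move=> stepX [cs [t [calls ops sXt run_t]]].
have [c [c_call c_op step_c]] := stepX t sXt.
exists (rcons cs c), (t ++ t'); split=> [|||u v].
- by rewrite -cats1 count_cat /= c_call addn0 calls addnC.
- by rewrite -cats1 count_cat /= c_op addn0 addnC leq_add2l.
- by move=> x [|/sXt] /= x_t; rewrite mem_cat x_t ?orbT.
- by rewrite -step_c -cats1 /run foldl_cat -/(run _ _ _) run_t.
Qed.

Lemma computable_const (c : R) K N X :
  computable K N X -> computable K N ((fun _ _ => c) |` X).
Proof.
rewrite -set_cons1; apply: (computable_step (call := false) (op := false)).
by move=> t _; exists (Const n c); split=> // u v; rewrite eval_at_cat cats1.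
Qed.

Lemma computable_op o x y z K N X :
  (forall u v, arith_eval o (x u v) (y u v) = Some (z u v)) ->
  X x -> X y -> computable K N X -> computable K N.+1 (z |` X).
Proof.
move=> xyz Xx Xy; rewrite -set_cons1.
apply: (computable_step (call := false) (op := true)) => t sXt.
exists (Op R n o (index x t) (index y t)); split=> // u v.
have [x_t y_t] := (sXt x Xx, sXt y Xy).
rewrite /= !size_map !index_mem x_t y_t !nth_eval_at // xyz.
by rewrite eval_at_cat cats1.
Qed.

Lemma computable_ops o s f g h K N X :
  (forall u v k,
     k \in s -> arith_eval o (f u v k) (g u v k) = Some (h u v k)) ->
  values s f `<=` X -> values s g `<=` X ->
  computable K N X -> computable K (size s + N) (values s h `|` X).
Proof.
move=> + + + C; elim: s => [|k s IH] fgh fX gX.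
  by rewrite /values set_nil set0U.
have k_ks := mem_head k s; have s_ks := mem_behead (s := k :: s).
have sub_values e := @values_subset _ _ e s_ks.
have {}IH := IH (fun u v j => fgh u v j \o s_ks j)
  (subset_trans (sub_values f) fX) (subset_trans (sub_values g) gX).
have := computable_op (fun u v => fgh u v k k_ks)
  (or_intror (fX _ (mem_values f k_ks))) (or_intror (gX _ (mem_values g k_ks)))
  IH.
apply: computableW => // x []; last by right; right.
by rewrite /values /= inE => /orP[/eqP->|h_s]; [left | right; left].
Qed.

Lemma computable_call a b K N X :
  (forall i, X (fun u v => a u v 0 i)) ->
  (forall i, X (fun u v => b u v 0 i)) ->
  computable K N X ->
  computable K.+1 N
    (values degrees (fun u v => F (a u v) (b u v)) `|` X).
Proof.
move=> aX bX; apply: (computable_step (call := true) (op := false)) => t sXt.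
exists (Call R (addresses t a) (addresses t b)); split=> // u v.
rewrite /step !load_addresses => [||k]; [|by move=> k; apply: sXt|exact: sXt].
by rewrite /= entries_row eval_at_cat [eval_at (map _ _) _ _]/eval_at -map_comp.
Qed.

Lemma computable_two_calls a b a' b' :
  (forall i, inputs (fun u v => a u v 0 i)) ->
  (forall i, inputs (fun u v => b u v 0 i)) ->
  (forall i, inputs (fun u v => a' u v 0 i)) ->
  (forall i, inputs (fun u v => b' u v 0 i)) ->
  computable 2 0
    (values degrees (fun u v => F (a u v) (b u v)) `|`
      (values degrees (fun u v => F (a' u v) (b' u v)) `|` inputs)).
Proof.
move=> a_in b_in a'_in b'_in.
apply: computable_call => [i|i|]; [by right | by right |].
exact: computable_call computable_inputs.
Qed.

Lemma program_of_computable K N f :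
  computable K N (values degrees f) ->
  exists P : program R n,
    [/\ num_calls P = K, (num_ops P <= N)%N &
        forall u v, exec oracle P u v = Some (\row_k f u v k)].
Proof.
move=> [cs [t [calls ops sft run_t]]].
exists (Program cs (addresses t (fun u v => \row_k f u v k))); split=> // u v.
rewrite /exec run_t /= load_addresses // => k.
have -> : (fun u v => (\row_(i < (n + n).-1) f u v i) 0 k) = fun u v => f u v k.
  by apply: eq2_fun => {}u {}v; rewrite mxE.
by apply/sft/mem_values; rewrite mem_iota ltn_ord.
Qed.

End ComputableValues.

Lemma linear_time_reduction_computable (R : realType) (k C : nat)
    (b b' : nat -> {poly R})
    (F F' : forall n, 'rV[R]_n -> 'rV[R]_n -> nat -> R) :
  graded b' -> product_coefs b F -> product_coefs b' F' ->
  (forall n, (0 < n)%N ->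
     computable (F' n) k (C * n) (values (iota 0 (n + n).-1) (F n))) ->
  linear_time_reduction k b b'.
Proof.
move=> graded_b' mulF mulF' compF; exists C => n /compF/program_of_computable.
move=> [P [calls ops execP]]; exists P; split=> // A mulA u v.
suff -> : A = oracle (F' n) by eexists; first exact: execP.
apply: eq2_fun => {}u {}v; have [w -> /esym] := mulA u v.
by rewrite -mulF' => /(lincomb_inj graded_b')<-.
Qed.

Section Reductions.
Variables (R : realType) (d : nat).
Local Notation n := d.+1.
Local Notation vec := 'rV[R]_n.
Local Notation degrees := (iota 0 (n + n).-1).
Implicit Types (F : vec -> vec -> nat -> R) (X : set (vec -> vec -> R)).

Lemma computable_conv_corr :
  computable (@conv R n) 2 d
    (values degrees (@conv R n) `|` values degrees (@corr R n)).
Proof.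
have := computable_const 0
  (computable_two_calls (@conv R n) (@inputsl R n) (@inputsr R n)
    (@inputsl R n) (@inputs_reversalr R n)).
set X := (X in computable _ _ _ X) => calls.
have zeroX : X (fun _ _ => 0) by left.
have crossX k : (k <= d + d)%N -> X (fun u v => conv u (reversal v) k).
  move=> le_k; right; right; left.
  apply: (mem_values (fun u v => conv u (reversal v))).
  by rewrite mem_iota; lia.
have sums : computable (@conv R n) 2 (size (iota 1 d) + 0)
    (values (iota 1 d) (@corr R n) `|` X).
  apply: (computable_ops (o := Add)
    (f := fun u v k => conv u (reversal v) (d + k))
    (g := fun u v k => conv u (reversal v) (d - k))) calls.
  - by move=> u v k; rewrite mem_iota => k_in; rewrite corr_reversal //; lia.
  - by move=> _ /mapP[k + ->]; rewrite mem_iota => k_in; apply: crossX; lia.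
  - by move=> _ /mapP[k + ->]; rewrite mem_iota => k_in; apply: crossX; lia.
apply: computableW sums; first by rewrite size_iota addn0.
move=> x [conv_x|/mapP[k _ ->]]; first by right; right; left.
have [->|k_gt0] := posnP k.
  by right; rewrite (eq2_fun (@corr0 R n)); apply: crossX; lia.
have [le_kd|lt_dk] := leqP k d.
  by left; apply: mem_values; rewrite mem_iota; lia.
by right; rewrite (eq2_fun (fun u v => corr_eq0 u v lt_dk)).
Qed.

Lemma computable_chebyshev_conv :
  computable (@conv R n) 2 (6 * n) (values degrees (@chebyshev_conv R n)).
Proof.
have := computable_const 2^-1 computable_conv_corr.
set X := (X in computable _ _ _ X) => conv_corr.
pose conv_add_corr (u v : vec) k := conv u v k + corr u v k.
have sums : computable (@conv R n) 2 (size degrees + d)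
    (values degrees conv_add_corr `|` X).
  apply: (computable_ops (o := Add)) conv_corr => // x; first by right; left.
  by right; right.
have halves : computable (@conv R n) 2 (size degrees + (size degrees + d))
    (values degrees (@chebyshev_conv R n) `|`
      (values degrees conv_add_corr `|` X)).
  apply: (computable_ops (o := Mul) (g := fun _ _ _ => 2^-1)) sums => // x.
  by move=> /mapP[k _ ->]; right; left.
by apply: computableW halves => [|x]; [rewrite !size_iota; lia | left].
Qed.

Lemma computable_conv_high (a b : vec -> vec -> vec) F K N X :
  values (iota n d) (fun u v => chebyshev_conv (a u v) (b u v)) `<=` X ->
  computable F K N X ->
  computable F K (d + N)
    (values (iota n d) (fun u v => conv (a u v) (b u v)) `|` X).
Proof.
move=> chebX; rewrite -[d in (d + N)%N](size_iota n d).
apply: (computable_ops (o := Add)) chebX (chebX) => u v k.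
rewrite mem_iota => /andP[le_nk _] /=.
by rewrite [in RHS]conv_of_chebyshev corr_eq0 ?subr0.
Qed.

Lemma computable_conv_off_middle :
  computable (@chebyshev_conv R n) 2 (d + d)
    (values [seq k <- degrees | k != d] (@conv R n) `|`
      (values degrees (@chebyshev_conv R n) `|` @inputs R n)).
Proof.
have := computable_two_calls (@chebyshev_conv R n)
  (@inputsl R n) (@inputsr R n) (@inputs_reversall R n) (@inputs_reversalr R n).
set X := (X in computable _ _ _ X) => calls.
have high_degrees : {subset iota n d <= degrees}.
  by move=> k; rewrite !mem_iota; lia.
have high := computable_conv_high (a := fun u _ => u) (b := fun _ v => v)
  (subset_trans (values_subset high_degrees) (@subsetUl _ _ _)) calls.
have low : computable (@chebyshev_conv R n) 2 (d + (d + 0))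
    (values (iota n d) (fun u v => conv (reversal u) (reversal v)) `|`
      (values (iota n d) (@conv R n) `|` X)).
  apply: computable_conv_high high => x x_cheb.
  by right; right; left; apply: values_subset x_cheb.
apply: computableW low => [|x]; first by rewrite addn0.
move=> [/mapP[k + ->]|[x_cheb|x_in]]; [|by right; right; left|by do 4 right].
rewrite mem_filter mem_iota => /andP[k_neq k_lt].
have [lt_kd|le_dk] := ltnP k d.
  have conv_rev (u v : vec) :
      conv u v k = conv (reversal u) (reversal v) (d + d - k).
    by rewrite conv_reversal; [congr conv|]; lia.
  left; rewrite (eq2_fun conv_rev).
  apply: (mem_values (fun u v => conv (reversal u) (reversal v))).
  by rewrite mem_iota; lia.
by right; left; apply: mem_values; rewrite mem_iota; lia.
Qed.

Lemma computable_corr_middle F K N X : @inputs R n `<=` X ->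
  computable F K N X -> computable F K (N + 3) ((fun u v => corr u v d) |` X).
Proof.
move=> inX C.
have uX i := inX _ (inputsl R i); have vX i := inX _ (inputsr R i).
pose outer (i j : 'I_n) (u v : vec) := u 0 i * v 0 j.
have [d0|d_gt0] := posnP d.
  rewrite (eq2_fun (fun u v => corr_ord_max0 u v d0)).
  have : computable F K N.+1 (outer ord0 ord0 |` X).
    by apply: (computable_op (o := Mul)) (uX ord0) (vX ord0) C.
  by apply: computableW; first by lia.
have product0d : computable F K N.+1 (outer ord0 ord_max |` X).
  by apply: (computable_op (o := Mul)) (uX ord0) (vX ord_max) C.
have productd0 : computable F K N.+2
    (outer ord_max ord0 |` (outer ord0 ord_max |` X)).
  apply: (computable_op (o := Mul)) product0d => //; right.
    exact: uX.
  exact: vX.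
have : computable F K N.+3 ((fun u v => corr u v d) |`
    (outer ord_max ord0 |` (outer ord0 ord_max |` X))).
  rewrite (eq2_fun (fun u v => corr_ord_max u v d_gt0)).
  by apply: (computable_op (o := Add)) productd0 => //; [right; left | left].
apply: computableW; first by lia.
by move=> x [|]; [left | right; right; right].
Qed.

Lemma computable_conv :
  computable (@chebyshev_conv R n) 2 (6 * n) (values degrees (@conv R n)).
Proof.
have := computable_conv_off_middle.
set X := (X in computable _ _ _ X) => off_middle.
have chebX : X (fun u v => chebyshev_conv u v d).
  by right; left; apply: mem_values; rewrite mem_iota; lia.
have inX : @inputs R n `<=` X by move=> x; right; right.
have corr_middle := computable_corr_middle inX off_middle.
pose twice_cheb (u v : vec) := chebyshev_conv u v d + chebyshev_conv u v d.
have twice : computable (@chebyshev_conv R n) 2 (d + d + 3).+1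
    (twice_cheb |` ((fun u v => corr u v d) |` X)).
  by apply: (computable_op (o := Add)) corr_middle => //; right.
have middle : computable (@chebyshev_conv R n) 2 (d + d + 3).+2
    ((fun u v => conv u v d) |`
      (twice_cheb |` ((fun u v => corr u v d) |` X))).
  rewrite (eq2_fun (fun u v => conv_of_chebyshev u v d)).
  by apply: (computable_op (o := Defs.Sub)) twice => //; [left | right; left].
apply: computableW middle => [|x /mapP[k k_in ->]]; first by lia.
have [->|k_neq] := eqVneq k d; first by left.
by do 3 right; left; apply: mem_values; rewrite mem_filter k_neq.
Qed.

End Reductions.

Theorem theorem1 (R : realType) :
  linear_time_reduction 2 (@monomial R) (@chebyshev R) /\
  linear_time_reduction 2 (@chebyshev R) (@monomial R).
Proof.
split.
- apply: (linear_time_reduction_computable (C := 6) (@graded_chebyshev R)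
    (@product_coefs_monomial R) (@product_coefs_chebyshev R)) => -[//|d] _.
  exact: computable_conv.
- apply: (linear_time_reduction_computable (C := 6) (@graded_monomial R)
    (@product_coefs_chebyshev R) (@product_coefs_monomial R)) => -[//|d] _.
  exact: computable_chebyshev_conv.
Qed.
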